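(* Let $n$ and $k$ be positive integers with $n\geq 2k$, let $G=\mathrm{S}_{n,k}$ be the symmetric group $\mathrm{S}_n$ acting on the set of $k$-element subsets of $\{1,2,\dots,n\}$, and let $H$ be a point stabiliser of $G$ in this action. Then $$b(G)=\mathrm{Diam}(\mathcal{K}(G,H))+1=d(1_H,\mathrm{sgn}{\downarrow_H})+1,$$ where $\mathrm{sgn}$ is the sign character of $\mathrm{S}_n$.
   Context: All characters are complex characters. A point stabiliser $H$ of $G=\mathrm{S}_{n,k}$ is the setwise stabiliser in $\mathrm{S}_n$ of a $k$-element subset of $\{1,\dots,n\}$. A base for a permutation group $G$ acting on a finite set $\Omega$ is a sequence of points of $\Omega$ whose pointwise stabiliser in $G$ is trivial; the base size $b(G)$ is the length of a shortest base. (For $\mathrm{S}_{n,k}$, $\Omega$ is the set of $k$-element subsets of $\{1,\dots,n\}$.) $1_H$ denotes the trivial character of $H$, and $\uparrow^G$ and $\downarrow_H$ denote induction of characters from $H$ to $G$ and restriction of characters from $G$ to $H$. The Külshammer graph $\mathcal{K}(G,H)$ has vertex set $\mathrm{Irr}(H)$ (the irreducible characters of $H$), with $\alpha$ adjacent to $\beta$ if and only if $\alpha{\uparrow^G}$ and $\beta{\uparrow^G}$ have a common irreducible constituent. This graph is connected. For $\alpha,\beta\in\mathrm{Irr}(H)$, $d(\alpha,\beta)$ is the length (number of edges) of a shortest path from $\alpha$ to $\beta$ in $\mathcal{K}(G,H)$ (so $d(\alpha,\alpha)=0$), and $\mathrm{Diam}(\mathcal{K}(G,H))=\max_{\alpha,\beta\in\mathrm{Irr}(H)}d(\alpha,\beta)$.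 *)

(* Defs.v *)
From mathcomp Require Export all_boot all_order all_fingroup all_algebra.
From mathcomp Require Export all_solvable all_field all_character.

Set Implicit Arguments.
Unset Strict Implicit.
Unset Printing Implicit Defensive.

Import GroupScope GRing.Theory.

(* The search bound in [base_size] loses nothing for a faithful action, since *)
(* the enumeration of S is then a base: see [base_sizeP].                     *)
Section BaseSize.

Variables (aT : finGroupType) (D : {group aT}) (T : finType).
Variables (to : action D T) (G : {group aT}) (S : {set T}).

Definition is_base (s : seq T) : bool :=
  all (fun x => x \in S) s && ('C_G([set x in s] | to) == 1).

Definition has_base (m : nat) : bool := [exists s : m.-tuple T, is_base s].

Definition base_size : nat := find has_base (iota 0 #|S|.+1).

Lemma base_sizeP : [faithful G, on S | to] ->
  (exists2 s : seq T, is_base s & size s = base_size)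
  /\ (forall s : seq T, is_base s -> (base_size <= size s)%N).
Proof.
move=> faithG.
have baseS : is_base (enum S).
  rewrite /is_base; apply/andP; split; first by apply/allP=> x; rewrite mem_enum.
  rewrite (_ : [set x in enum S] = S); last by apply/setP=> x; rewrite inE mem_enum.
  by rewrite -subG1.
have hasb s : is_base s -> has_base (size s).
  by move=> bs; apply/existsP; exists (in_tuple s).
have hasS : has has_base (iota 0 #|S|.+1).
  apply/hasP; exists #|S|; first by rewrite mem_iota /= add0n ltnS.
  by rewrite cardE; apply: hasb.
have ltb : (base_size < #|S|.+1)%N by have := hasS; rewrite has_find size_iota.
split=> [|s bs].
  have := nth_find 0 hasS; rewrite nth_iota // add0n => /existsP[s bs].
  by exists s; rewrite ?size_tuple.
rewrite leqNgt; apply/negP=> lts.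
have := before_find 0 lts; rewrite nth_iota ?(ltn_trans lts) // add0n.
by rewrite hasb.
Qed.

End BaseSize.

(* For a finite graph, given by its adjacency relation. A shortest path has   *)
(* fewer edges than there are vertices, so the search bound in [gdist] loses  *)
(* nothing; the value is #|T| when there is no path from x to y.              *)
Section Distance.

Variables (T : finType) (e : rel T).

Definition has_path (x y : T) (m : nat) : bool :=
  [exists p : m.-tuple T, path e x p && (last x p == y)].

Definition gdist (x y : T) : nat := find (has_path x y) (iota 0 #|T|).

Definition diam : nat := \max_(x : T) \max_(y : T) gdist x y.

Lemma gdistP x y : connect e x y ->
  (exists p : seq T, [/\ path e x p, last x p = y & size p = gdist x y])
  /\ (forall p : seq T, path e x p -> last x p = y -> (gdist x y <= size p)%N).
Proof.
move=> /connectP[p0 /shortenP[p ep Up _] def_y].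
have hasp q : path e x q -> last x q = y -> has_path x y (size q).
  by move=> eq lq; apply/existsP; exists (in_tuple q); rewrite eq lq eqxx.
have hasT : has (has_path x y) (iota 0 #|T|).
  apply/hasP; exists (size p); last exact: hasp.
  rewrite mem_iota /= add0n -[(size p).+1]/(size (x :: p)).
  by rewrite -(card_uniqP Up) max_card.
have ltd : (gdist x y < #|T|)%N by have := hasT; rewrite has_find size_iota.
split=> [|q eq lq].
  have := nth_find 0 hasT; rewrite nth_iota // add0n.
  by case/existsP=> q /andP[eq /eqP lq]; exists q; rewrite size_tuple.
rewrite leqNgt; apply/negP=> ltq.
have := before_find 0 ltq; rewrite nth_iota ?(ltn_trans ltq) // add0n.
by rewrite hasp.
Qed.

End Distance.

(* Vertices are indices of irreducible characters, [irr H] being duplicate    *)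
(* free. Every vertex carries a loop, which does not affect distances.        *)
Definition kulshammer (gT : finGroupType) (G H : {group gT}) : rel (Iirr H) :=
  fun a b => [exists i : Iirr G,
    (i \in irr_constt ('Ind[G] 'chi[H]_a)%R)
    && (i \in irr_constt ('Ind[G] 'chi[H]_b)%R)].

Arguments kulshammer {gT} G H.

Definition ksubsets (n k : nat) : {set {set 'I_n}} :=
  [set A : {set 'I_n} | #|A| == k].

Lemma sgn_subproof n :
  is_class_fun <<[set: 'S_n]>> [ffun s : 'S_n => ((-1) ^+ odd_perm s : algC)%R].
Proof.
apply: intro_class_fun => [s t _ _|s].
  by rewrite odd_permJ.
by case/negP; apply: mem_gen; rewrite inE.
Qed.

Definition sgn (n : nat) : 'CF([set: 'S_n]) := Cfun 0 (@sgn_subproof n).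

Definition sgn_Iirr (n : nat) (H : {group 'S_n}) : Iirr H :=
  cfIirr ('Res[H] (sgn n))%R.

Lemma sgn_lin_char n : sgn n \is a linear_char.
Proof.
pose rV (s : 'S_n) : 'M[algC]_1 := (((-1) ^+ odd_perm s)%R)%:M%R.
have rVP : mx_repr [set: 'S_n] rV.
  split=> [|s t _ _]; first by rewrite /rV odd_perm1.
  by rewrite /rV odd_permM signr_addb scalar_mxM.
rewrite qualifE /= cfunE odd_perm1 eqxx andbT.
suff -> : sgn n = cfRepr (MxRepresentation rVP) by apply: cfRepr_char.
by apply/cfun_inP=> s Gs; rewrite !cfunE Gs mulr1n /= mxtrace_scalar.
Qed.

Lemma sgn_IirrE n (H : {group 'S_n}) : ('chi_(sgn_Iirr H) = 'Res[H] (sgn n))%R.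
Proof. by rewrite cfIirrE // lin_char_irr // cfRes_lin_char // sgn_lin_char. Qed.

(* Main.v *)
Require Import Defs.
From mathcomp Require Import zify.
Import GroupScope GRing.Theory Num.Theory.
Set Implicit Arguments.
Unset Strict Implicit.
Unset Printing Implicit Defensive.

Local Open Scope ring_scope.

(** The distance in the Külshammer graph of H <= G is governed by the operator
    R = Res_H o Ind^G on characters of H. By Frobenius reciprocity a and b are
    adjacent exactly when '[chi_a, R chi_b] != 0, and since all multiplicities
    are nonnegative there is a walk of length m from a to b exactly when chi_b
    is a constituent of R^m chi_a ([kulshammer_pathP]).

    Mackey's formula ([cfdot_Res_Ind]), applied m times, expresses
    '[R^m phi, psi] as a sum over m-tuples (y_i) of elements of G, with positive
    coefficients, of inner products of a conjugate of phi with psi, both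
    restricted to L_y = H :&: H :^ y_1 :&: ... :&: H :^ y_m.
    If G acts transitively with point stabiliser H, the L_y are the pointwise
    stabilisers of the (m + 1)-tuples of points that start with the point
    stabilised by H. This gives two bounds, valid for every faithful transitive
    action with base size b.

    - A base of size m + 1 provides a tuple with L_y = 1, whose term is a
      positive multiple of phi(1)psi(1). All terms being nonnegative, any two
      vertices are joined by a walk of length m. Hence the diameter is at most
      b - 1 ([diam_kulshammer_le]).
    - If lam is a linear character of G that is nontrivial on every nontrivial
      pointwise stabiliser, then for m + 1 < b no L_y is trivial, so every term
      of '[R^m 1_H, Res_H lam] is the inner product of two distinct linear
      characters and vanishes. Hence b - 1 is at most the distance from 1_H to
      Res_H lam ([base_size_le_gdist]).

    In the symmetric group acting on k-subsets, sgn is such a character: the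
    pointwise stabiliser of a family of subsets is a Young subgroup, and if it
    moves i to j then it contains the transposition of i and j
    ([astab_sets_tperm]). The two bounds then meet. *)

(** * Iterated induction and restriction *)

(** Mackey's formula, summed over all of G rather than over double coset
    representatives: this makes the coefficients explicit without choosing
    representatives, and only their positivity matters below. Conjugating K
    instead of H keeps the left-hand character on H, so that the formula can be
    iterated when chi is itself restricted from an induced character. *)
Lemma cfdot_Res_Ind (gT : finGroupType) (G H K : {group gT})
    (chi : 'CF(H)) (psi : 'CF(K)) : H \subset G -> K \subset G ->
  '['Res[K] ('Ind[G] chi), psi]
    = \sum_(y in G) #|K :^ y :&: H|%:R / (#|K|%:R * #|H|%:R) *
        '['Res[K :^ y :&: H] chi,
          'Res[K :^ y :&: H] (cfIsom (conj_isom K y) psi)].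
Proof.
move=> sHG sKG; rewrite cfdotE.
under eq_bigr => k Kk do
  rewrite cfResE // cfIndE // -mulrA mulr_suml mulr_sumr.
rewrite exchange_big mulr_sumr /=; apply: eq_bigr => y Gy.
rewrite cfdotE mulrA [X in _ = X * _]mulrAC divff ?neq0CG // mul1r invfM -mulrA.
congr (_ * _); rewrite -mulr_sumr; congr (_ * _).
rewrite [RHS](reindex_inj (conjg_inj y)) /=.
rewrite [LHS](bigID (fun k => (k ^ y)%g \in H)) /= [X in _ + X]big1 ?addr0.
  apply: eq_big => [k | k /andP[Kk Hky]]; first by rewrite inE memJ_conjg.
  have Lky: (k ^ y \in K :^ y :&: H)%g by rewrite inE memJ_conjg Kk.
  rewrite !cfResE ?subsetIl ?subsetIr //.
  by rewrite -(conjgmE K y) cfIsomE // conjgmE.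
by move=> k /andP[Kk /cfun0->]; rewrite mul0r.
Qed.

(** The change of variables that turns the conjugation of K in
    [cfdot_Res_Ind] into one more conjugate of H. *)
Lemma conjs_cap_bigcap (gT : finGroupType) (H K : {group gT}) (y : gT) s :
  (K :^ y :&: H) :&: \bigcap_(z <- [seq (z * y)%g | z <- s]) H :^ z
    = (K :&: \bigcap_(z <- y^-1%g :: s) H :^ z) :^ y.
Proof.
rewrite big_cons setIA !conjIg conjsgKV big_map; congr (_ :&: _).
elim: s => [|z s IHs]; first by rewrite !big_nil conjTg.
by rewrite !big_cons conjIg IHs conjsgM.
Qed.

Section Iteration.

Variables (gT : finGroupType) (G H : {group gT}).
Hypothesis sHG : H \subset G.

Definition res_ind (phi : 'CF(H)) : 'CF(H) := 'Res[H] ('Ind[G] phi).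

Lemma iter_res_ind_char m phi :
  phi \is a character -> iter m res_ind phi \is a character.
Proof. by move=> Nphi; elim: m => //= m /(cfInd_char G)/(cfRes_char H).
Qed.

(** Multiplicities of characters are nonnegative, so there is no
    cancellation in the expansion of '[phi, psi] over the irreducibles. *)
Lemma cfdot_char_neq0P (K : {group gT}) (phi psi : 'CF(K)) :
    phi \is a character -> psi \is a character ->
  reflect (exists2 c, c \in irr_constt phi & c \in irr_constt psi)
          ('[phi, psi] != 0).
Proof.
move=> Nphi Npsi; apply: (iffP idP) => [nz | [c cphi cpsi]].
  have [/exists_inP[c]|] :=
    boolP [exists c in irr_constt phi, c \in irr_constt psi]; first by exists c.
  rewrite negb_exists_in => /forall_inP no_c; case/eqP: nz.
  rewrite cfdot_sum_irr big1 // => c _.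
  have [->|/no_c] := eqVneq '[phi, 'chi_c] 0; first by rewrite mul0r.
  by rewrite irr_consttE negbK => /eqP->; rewrite conjC0 mulr0.
apply: contraTneq isT => /(constt_ortho_char Nphi Npsi cphi cpsi)/eqP.
by rewrite cfdot_irr eqxx oner_eq0.
Qed.

Lemma kulshammerE a b :
  kulshammer G H a b = ('['chi_a, res_ind 'chi_b] != 0).
Proof.
rewrite cfdot_Res_r; apply/exists_inP/cfdot_char_neq0P.
1,2: by rewrite cfInd_char ?irr_char.
all: by case=> i; exists i.
Qed.

Lemma Res_res_ind (K : {group gT}) phi :
  K \subset H -> 'Res[K] (res_ind phi) = 'Res[K] ('Ind[G] phi).
Proof. by move=> sKH; rewrite cfResRes. Qed.

Lemma cfdot_res_ind phi psi : '[res_ind phi, psi] = '[phi, res_ind psi].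
Proof. by rewrite /res_ind cfdot_Res_l cfdot_Res_r. Qed.

Lemma kulshammer_pathP m a b :
  reflect (exists p, [/\ path (kulshammer G H) a p, last a p = b & size p = m])
          (b \in irr_constt (iter m res_ind 'chi_a)).
Proof.
have Nit k c : iter k res_ind 'chi_c \is a character.
  by rewrite iter_res_ind_char ?irr_char.
elim: m b => [|m IHm] b.
  rewrite irr_consttE cfdot_irr pnatr_eq0 eqb0 negbK.
  apply: (iffP eqP) => [->|]; first by exists [::].
  by case=> -[|? ?] [].
rewrite irr_consttE /= cfdot_res_ind.
apply: (iffP (cfdot_char_neq0P (Nit m a) (Nit 1%N b))).
  case=> c /IHm[p [ep <- <-]] ecb; exists (rcons p b).
  rewrite last_rcons size_rcons rcons_path ep kulshammerE.
  by rewrite cfdotC fmorph_eq0.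
case=> p; case/lastP: p => [|p b'] [] //.
rewrite last_rcons size_rcons rcons_path kulshammerE => /andP[ep ecb] eb [sp].
move: ecb; rewrite eb cfdotC fmorph_eq0 => ecb.
by exists (last a p) => //; apply/IHm; exists p.
Qed.

(** Each step of the induction absorbs one conjugate of H into K. The
    terms of Mackey's formula are nonnegative, so it suffices to keep the one
    indexed by y^-1; once K is trivial, the inner product is the product of the
    degrees. *)
Lemma cfdot_iter_res_ind_neq0 (K : {group gT}) (s : seq gT) chi (psi : 'CF(K)) :
    K \subset H -> {subset s <= G} ->
    K :&: \bigcap_(y <- s) (H :^ y) = 1%g ->
    chi \is a character -> psi \is a character -> chi != 0 -> psi != 0 ->
  '['Res[K] (iter (size s) res_ind chi), psi] != 0.
Proof.
move=> + + + Nchi + nz_chi.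
elim: {s}(size s) {-2}s (erefl (size s)) K psi => [|m IHm] [|y s] //=.
  move=> _ K psi sKH _; rewrite big_nil setIT => K1 Npsi nz_psi.
  rewrite cfdotE (big_pred1 1%g) => [|k]; last by rewrite K1 inE.
  by rewrite cfResE // !mulf_neq0 ?invr_eq0 ?neq0CG ?fmorph_eq0 ?char1_eq0.
move=> [sz_s] K psi sKH sG triv Npsi nz_psi.
have Gy: y \in G by rewrite sG ?mem_head.
have Nit := iter_res_ind_char m Nchi.
have cf_ge0 z : 0 <= #|K :^ z :&: H|%:R / (#|K|%:R * #|H|%:R) *
   '['Res[K :^ z :&: H] (iter m res_ind chi),
          'Res[K :^ z :&: H] (cfIsom (conj_isom K z) psi)].
  apply: mulr_ge0; first by rewrite divr_ge0 ?mulr_ge0 ?ler0n.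
  by apply: natr_ge0; rewrite Cnat_cfdot_char ?cfRes_char ?cfIsom_char.
rewrite sz_s Res_res_ind // cfdot_Res_Ind ?(subset_trans sKH) //.
rewrite psumr_neq0; last by move=> z _; apply: cf_ge0.
apply/hasP; exists y^-1%g; first by rewrite mem_index_enum.
rewrite groupV Gy lt0r cf_ge0 andbT /=.
apply: mulf_neq0; first by rewrite !mulf_neq0 ?invr_eq0 ?mulf_neq0 ?neq0CG.
rewrite -(size_map (fun z => z * y^-1)%g) in sz_s; rewrite -sz_s.
apply: IHm => //.
- exact: subsetIr.
- move=> _ /mapP[z sz ->].
  by rewrite groupM ?groupV // sG // in_cons sz orbT.
- by rewrite conjs_cap_bigcap invgK triv conjs1g.
- by rewrite cfRes_char ?cfIsom_char.
- have Npsi' :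
      'Res[K :^ y^-1 :&: H] (cfIsom (conj_isom K y^-1) psi) \is a character.
    by rewrite cfRes_char ?cfIsom_char.
  by rewrite -(char1_eq0 Npsi') cfResE ?subsetIl // cfIsom1 char1_eq0.
Qed.

(** The hypothesis on K is stable under K |-> K :^ y :&: H with m decreased,
    and conjugation fixes lam because lam is defined on all of G; so every term
    of Mackey's formula vanishes, down to m = 0 where two distinct linear
    characters of K are compared. *)
Lemma cfdot_iter_res_ind_lin (lam : 'CF(G)) m (K : {group gT}) :
    lam \is a linear_char -> K \subset H ->
    (forall s : seq gT, size s = m -> {subset s <= G} ->
       exists2 g, g \in K :&: \bigcap_(y <- s) (H :^ y) & lam g != 1) ->
  '['Res[K] (iter m res_ind 1), 'Res[K] lam] = 0.
Proof.
move=> lin_lam; elim: m K => [|m IHm] K sKH nker.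
  have [||g] := nker [::]; rewrite ?big_nil ?setIT // => Kg lam_g.
  have sKG := subset_trans sKH sHG.
  have irr_lam : 'Res[K] lam \in irr K by rewrite lin_char_irr ?cfRes_lin_char.
  rewrite /= cfRes_cfun1 //; have /irrP[i ei] := irr_lam.
  rewrite ei -irr0 cfdot_irr; case: eqP => // e0i.
  by case/eqP: lam_g; rewrite -(cfResE _ sKG Kg) ei -e0i irr0 cfun1E Kg.
have sKG := subset_trans sKH sHG.
rewrite /= Res_res_ind // cfdot_Res_Ind // big1 // => y Gy.
set L := (K :^ y :&: H)%G.
have sLH : L \subset H by apply: subsetIr.
have -> : 'Res[L] (cfIsom (conj_isom K y) ('Res[K] lam)) = 'Res[L] lam.
  apply/cfun_inP=> _ /[dup] /setIP[/imsetP[k Kk ->] _] Lky.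
  rewrite (cfResE _ (subsetIl _ _)) // (cfResE _ (subset_trans sLH sHG)) //.
  by rewrite -{1}(conjgmE K y) cfIsomE // cfResE // cfunJ.
rewrite IHm ?mulr0 // => s sz_s sG.
have [||g /setIP[Kg sg] lam_g] := nker (y^-1 :: map (fun z => z * y^-1) s)%g.
- by rewrite /= size_map sz_s.
- move=> z; rewrite inE => /predU1P[->|/mapP[t st ->]]; rewrite ?groupV //.
  by rewrite groupM ?groupV // sG.
exists (g ^ y)%g; last by rewrite cfunJ.
have -> : s = [seq (z * y)%g | z <- [seq (z * y^-1)%g | z <- s]].
  by rewrite -map_comp map_id_in // => z _ /=; rewrite mulgKV.
by rewrite conjs_cap_bigcap memJ_conjg inE Kg.
Qed.

End Iteration.

(** * Transitive actions *)

Section Action.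

Variables (gT : finGroupType) (T : finType) (to : {action gT &-> T}).
Variables (G H : {group gT}) (S : {set T}) (x : T).
Hypotheses (Sx : x \in S) (trG : [transitive G, on S | to]).
Hypotheses (faithG : [faithful G, on S | to]) (defH : H :=: 'C_G[x | to]).

Let sHG : H \subset G. Proof. by rewrite defH subsetIl. Qed.

Lemma astab_seq_conj (s : seq gT) : {subset s <= G} ->
  'C_G([set z in [seq to x y | y <- s]] | to) = G :&: \bigcap_(y <- s) H :^ y.
Proof.
elim: s => [|y s IHs] sG /=.
  rewrite big_nil set_nil setIT; apply/setIidPl/subsetP=> a _.
  by apply/astabP=> z; rewrite inE.
have Gy : y \in G by rewrite sG ?mem_head.
rewrite big_cons set_cons astabU setIIr IHs => [|z sz]; last first.
  by rewrite sG // in_cons sz orbT.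
rewrite astab1_act defH (conjIg G 'C[x | to]) conjGid //.
by apply/setP=> a; rewrite !in_setI; case: (a \in G).
Qed.

(** Translating a base so that its first point becomes x costs one point:
    the remaining ones give the conjugates of H whose intersection with H is
    trivial. *)
Lemma path_of_base b c s : is_base to G S s ->
  exists p, [/\ path (kulshammer G H) b p, last b p = c & size p = (size s).-1].
Proof.
case/andP=> /allP sS /eqP triv.
have [s' s'G ds] : exists2 s', {subset s' <= G} & s = [seq to x y | y <- s'].
  elim: s sS {triv} => [|z s IHs] sS; first by exists [::].
  have [|s' s'G ->] := IHs; first by move=> t st; rewrite sS // in_cons st orbT.
  have [|y Gy ->] := atransP2 trG Sx (sS z _); first exact: mem_head.
  exists (y :: s') => // t; rewrite in_cons => /predU1P[->//|]; exact: s'G.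
(* If s is empty then G is trivial, and t is empty since (size s).-1 is 0. *)
have [t [sz_t tG triv_t]] : exists t, [/\ size t = (size s).-1, {subset t <= G}
    & H :&: \bigcap_(y <- t) H :^ y = 1%g].
  rewrite ds astab_seq_conj // in triv; rewrite {}ds.
  case: s' => [|y s'] in s'G triv *.
    exists [::]; split=> //; rewrite big_nil setIT in triv *.
    by rewrite setIT; apply/eqP; rewrite -subG1 -triv.
  have Gy : y \in G by rewrite s'G ?mem_head.
  exists [seq (z * y^-1)%g | z <- s']; split; first by rewrite !size_map.
    move=> _ /mapP[z sz ->].
    by rewrite groupM ?groupV // s'G // in_cons sz orbT.
  have := conjs_cap_bigcap H G y^-1 s'.
  by rewrite invgK triv conjs1g conjGid ?groupV // (setIidPr sHG).
apply/kulshammer_pathP => //; rewrite irr_consttE -sz_t.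
rewrite -[X in '[X, _]]cfRes_id cfdot_iter_res_ind_neq0 ?irr_char //.
all: by rewrite irr_neq0.
Qed.

Lemma diam_kulshammer_le : (diam (kulshammer G H) <= (base_size to G S).-1)%N.
Proof.
have [[s bs <-] _] := base_sizeP faithG.
apply/bigmax_leqP=> b _; apply/bigmax_leqP=> c _.
have [p [ep lp <-]] := path_of_base b c bs.
have [|_] := @gdistP _ (kulshammer G H) b c; last exact.
by apply/connectP; exists p.
Qed.

(** If the distance d were less than b - 1, no sequence of d + 1 points would
    be a base, so lam would be nontrivial on the stabiliser of each of them,
    and the restriction of lam to H could not be a constituent of the d-th
    iterate of [res_ind] at the trivial character. *)
Lemma base_size_le_gdist (lam : 'CF(G)) (l : Iirr H) :
    lam \is a linear_char -> 'chi_l = 'Res[H] lam ->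
    (forall s : seq T, all (fun z => z \in S) s ->
       {in 'C_G([set z in s] | to), forall g, lam g = 1} ->
       'C_G([set z in s] | to) = 1%g) ->
  (base_size to G S <= (gdist (kulshammer G H) 0%R l).+1)%N.
Proof.
move=> lin_lam chi_l ker1.
have [[s bs _] min_b] := base_sizeP faithG.
have [|[p [ep lp sz_p]] _] := @gdistP _ (kulshammer G H) 0 l.
  by have [p [ep lp _]] := path_of_base 0 l bs; apply/connectP; exists p.
rewrite leqNgt; apply/negP=> ltdb.
have : l \in irr_constt (iter (gdist (kulshammer G H) 0 l) (@res_ind _ G H) 'chi_0).
  by apply/kulshammer_pathP; exists p.
rewrite irr_consttE -[X in '[X, _]]cfRes_id chi_l irr0.
rewrite cfdot_iter_res_ind_lin ?eqxx // => t sz_t tG.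
(* The point x itself comes first: it accounts for the factor H. *)
pose t1 := 1%g :: t.
have t1G : {subset t1 <= G}.
  by move=> y; rewrite inE => /predU1P[->|/tG].
have t1S : all (fun z => z \in S) [seq to x y | y <- t1].
  apply/allP=> _ /mapP[y /t1G Gy ->].
  by rewrite (acts_act (atrans_acts trG)).
have eqC : 'C_G([set z in [seq to x y | y <- t1]] | to)
    = H :&: \bigcap_(y <- t) H :^ y.
  by rewrite astab_seq_conj // big_cons conjsg1 setIA (setIidPr sHG).
have [/exists_inP[g] |] :=
  boolP [exists g in H :&: \bigcap_(y <- t) H :^ y, lam g != 1].
  by exists g.
rewrite negb_exists_in => /forall_inP lam1.
have : is_base to G S [seq to x y | y <- t1].
  apply/andP; split=> //; apply/eqP/ker1 => // g; rewrite eqC => /lam1.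
  by rewrite negbK => /eqP.
by move/min_b; rewrite size_map /= sz_t leqNgt ltdb.
Qed.

End Action.

(** * The symmetric group on k-subsets *)

Section Subsets.

Variables (n k : nat).

(** The indicator tuples of two k-subsets have the same numbers of entries
    true and false, hence are rearrangements of each other. *)
Lemma ksubsets_trans (A : {set 'I_n}) : A \in ksubsets n k ->
  [transitive [set: 'S_n], on ksubsets n k | 'P^*].
Proof.
rewrite inE => /eqP cA.
apply/imsetP; exists A; first by rewrite inE cA.
apply/setP=> B; rewrite inE; apply/eqP/imsetP => [cB | [g _ ->]]; last first.
  by rewrite /= setactE card_imset //; apply: perm_inj.
have countE b (C : {set 'I_n}) :
    count_mem b [tuple i \in C | i < n] = if b then #|C| else (n - #|C|)%N.
  have countT : count_mem true [tuple i \in C | i < n] = #|C|.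
    rewrite /= count_map cardE [in RHS]/enum_mem size_filter -enumT.
    by apply: eq_count => i /=; rewrite eqb_id.
  case: b => //; have := count_predC (pred1 true) [tuple i \in C | i < n].
  rewrite countT size_tuple => /(canRL (addKn _)) <-.
  by apply: eq_count => -[].
have : perm_eq [tuple i \in A | i < n] [tuple i \in B | i < n].
  by apply/allP=> b _; rewrite inE !countE cA cB.
case/tuple_permP=> p eAB; exists p; first by rewrite inE.
have memA i : (i \in A) = (p i \in B).
  have /(congr1 (fun t : n.-tuple bool => tnth t i)) := val_inj eAB.
  by rewrite !tnth_mktuple.
apply/setP=> i; rewrite /= setactE -(permKV p i).
by rewrite mem_imset ?memA ?permKV //; apply: perm_inj.
Qed.

(** A point i moved to g i is separated from it by a k-subset containing i
    but not g i, which g cannot fix. *)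
Lemma ksubsets_faithful : (0 < k)%N -> (k < n)%N ->
  [faithful [set: 'S_n], on ksubsets n k | 'P^*].
Proof.
move=> k_gt0 lt_kn; rewrite /faithful setTI; apply/subsetP=> g /astabP fix_g.
rewrite inE; apply/eqP/permP=> i; rewrite perm1; apply/eqP.
apply: contraTT isT => neq_gi.
have : (k.-1 <= #|[set~ i] :\ g i|)%N.
  have := cardsC1 i; rewrite card_ord (cardsD1 (g i)) !inE neq_gi; lia.
rewrite -bin_gt0 -cards_draws => /card_gt0P[B].
rewrite inE => /andP[/subsetP sB /eqP cB].
have iB : i \notin B by apply/negP=> /sB; rewrite !inE eqxx andbF.
have giB : g i \notin B by apply/negP=> /sB; rewrite !inE eqxx.
have /fix_g : i |: B \in ksubsets n k by rewrite inE cardsU1 iB cB; lia.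
move/setP/(_ (g i)); rewrite /= setactE mem_imset; last exact: perm_inj.
by rewrite !inE eqxx (negPf neq_gi) (negPf giB).
Qed.

(** A family of subsets fixed by g does not separate i from g i, so the
    transposition of these two points fixes the family as well; it is odd. *)
Lemma astab_sets_tperm (s : seq {set 'I_n}) :
    {in 'C([set B in s] | 'P^*), forall g : 'S_n, sgn n g = 1} ->
  'C([set B in s] | 'P^*) = 1%g.
Proof.
move=> sgn1; apply/trivgP/subsetP=> g /astabP fix_g.
rewrite inE; apply/eqP/permP=> i; rewrite perm1; apply/eqP.
apply: contraTT isT => neq_gi.
have /sgn1 : tperm i (g i) \in 'C([set B in s] | 'P^*).
  apply/astabP=> B sB.
  have memB : (g i \in B) = (i \in B).
    by rewrite -{1}(fix_g B sB) /= setactE mem_imset //; apply: perm_inj.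
  apply/setP=> j; rewrite /= setactE -{1}(tpermK i (g i) j).
  rewrite mem_imset; last exact: perm_inj.
  by case: tpermP => // ->.
rewrite cfunElock odd_tperm eq_sym neq_gi expr1 => /eqP.
by rewrite -subr_eq0 -opprD oppr_eq0 (pnatr_eq0 _ 2).
Qed.

End Subsets.

Theorem corollary1p3 (n k : nat) (k_gt0 : (0 < k)%N) (le_2k_n : (2 * k <= n)%N)
    (A : {set 'I_n}) (A_k : A \in ksubsets n k)
    (H : {group 'S_n}) (defH : H :=: 'C_[set: 'S_n][A | 'P^*]) :
  let G := [set: 'S_n]%G in
  base_size 'P^* G (ksubsets n k) = (diam (kulshammer G H) + 1)%N
  /\ (diam (kulshammer G H) + 1 = gdist (kulshammer G H) 0%R (sgn_Iirr H) + 1)%N.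
Proof.
move=> G; rewrite !addn1.
have trG := ksubsets_trans A_k.
have faithG : [faithful G, on ksubsets n k | 'P^*].
  apply: ksubsets_faithful => //; lia.
have b_gt0 : (0 < base_size 'P^* G (ksubsets n k))%N.
  have [[s bs <-] _] := base_sizeP faithG.
  case: s bs => // /andP[_]; rewrite set_nil setTI => /eqP C0.
  have n1 : (1 < n)%N by lia.
  have : tperm (Ordinal (ltnW n1)) (Ordinal n1) \in 'C(set0 | 'P^*).
    by apply/astabP=> B; rewrite inE.
  by rewrite C0; move/set1P/(congr1 (@odd_perm _)); rewrite odd_tperm odd_perm1.
have le_diam := diam_kulshammer_le A_k trG faithG defH.
have le_b : (base_size 'P^* G (ksubsets n k)
    <= (gdist (kulshammer G H) 0%R (sgn_Iirr H)).+1)%N.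
  apply: (base_size_le_gdist A_k trG faithG defH (sgn_lin_char n)).
    exact: sgn_IirrE.
  by move=> s _; rewrite setTI; apply: astab_sets_tperm.
have le_d : (gdist (kulshammer G H) 0%R (sgn_Iirr H) <= diam (kulshammer G H))%N.
  by apply: (bigmax_sup 0%R) => //; apply: (bigmax_sup (sgn_Iirr H)).
rewrite -ltnS (prednK b_gt0) in le_diam.
split; apply/eqP; rewrite eqn_leq.
  by rewrite le_diam (leq_trans le_b).
by rewrite !ltnS le_d andbT -ltnS (leq_trans le_diam).
Qed.
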